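(* Let $d$ be an integer with $0\le d\le n-1$. Then every friendly measure on $F^n$ is $d$-contracting almost everywhere.
   Context: Let $q=p^d$ with $p$ prime (here the symbol $d$ in $q=p^d$ is unrelated to the dimension $d$ in the claim), $F=\mathbb{F}_q((X^{-1}))$ with absolute value $|\sum_{\ell\le\ell_0}a_\ell X^\ell|=e^{\ell_0}$ when $a_{\ell_0}\ne0$, $|0|=0$, and $F^n$ with the sup norm and distance $\mathrm{dist}(\mathbf y,A)=\inf_{\mathbf a\in A}\|\mathbf y-\mathbf a\|$. For a Borel measure $\mu$ on $F^n$: its support $S$ is the smallest closed set of full measure; $aB$ is the ball concentric with $B$ of $a$ times the radius; $\mu$ is non-atomic if points have measure $0$; doubling if there is $c>0$ with $\mu(2B)\le c\mu(B)$ for all balls $B$ centred in $S$; non-planar if $\mu(\mathcal L)=0$ for every affine hyperplane $\mathcal L$. For a hyperplane $\mathcal L$ and ball $B$ with $\mu(B)>0$, $\|d_{\mathcal L}\|_{\mu,B}=\sup\{\mathrm{dist}(\mathbf y,\mathcal L):\mathbf y\in S\cap B\}$. $\mu$ is $(C,\alpha)$-decaying on an open set $V$ if for every nonempty open ball $B\subset V$ centred in $S$, every affine hyperplane $\mathcal L$ and every $\varepsilon>0$, $\mu(B\cap\mathcal L^{(\varepsilon)})\le C(\varepsilon/\|d_{\mathcal L}\|_{\mu,B})^\alpha\mu(B)$, where $\mathcal L^{(\varepsilon)}=\{\mathbf y:\mathrm{dist}(\mathbf y,\mathcal L)<\varepsilon\}$. A non-atomic Borel measure $\mu$ is friendly if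 for $\mu$-a.e. $\mathbf y_0$ there is a neighbourhood $V$ of $\mathbf y_0$ with $\mu|_V$ finite, doubling, non-planar and $(C,\alpha)$-decaying on $V$ for some $C,\alpha>0$. A finite, non-atomic, doubling Borel measure $\mu$ on $F^n$ with support $S$ is $d$-contracting if there are $C',\alpha',r_0>0$ such that for every $d$-dimensional affine plane $\mathcal L\subset F^n$, every $0<\varepsilon<r_0$ and every $0<\delta<1$: for every $\mathbf y\in\mathcal L^{(\delta\varepsilon)}\cap S$ there is an open ball $B$ centred at $\mathbf y$ with $B\cap S\subset\mathcal L^{(\varepsilon)}$ and $\mu(5B\cap\mathcal L^{(\delta\varepsilon)})\le C'\delta^{\alpha'}\mu(5B)$. $\mu$ is $d$-contracting almost everywhere if for $\mu$-a.e. $\mathbf y_0$ there is a neighbourhood $V$ of $\mathbf y_0$ such that $\mu|_V$ is $d$-contracting. *)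

(* Defs.v *)
From HB Require Import structures.
From mathcomp Require Import all_boot all_order all_algebra.
From mathcomp Require Import all_classical all_reals all_analysis.
From mathcomp Require Import ring lra zify.

Set Implicit Arguments.
Unset Strict Implicit.
Unset Printing Implicit Defensive.

Import Order.TTheory GRing.Theory Num.Theory.
Import numFieldNormedType.Exports.

Local Open Scope classical_set_scope.
Local Open Scope ring_scope.

(* Formal Laurent series in X^-1: [coef a l] is the coefficient of X^l, and the
   exponents are bounded above. *)
Record laurent (k : fieldType) := Laurent {
  coef :> int -> k ;
  coef_bounded : exists N : int, forall l : int, N < l -> coef l = 0 }.

HB.instance Definition _ (k : fieldType) := gen_eqMixin (laurent k).
HB.instance Definition _ (k : fieldType) := gen_choiceMixin (laurent k).

Section LaurentField.
Variable k : fieldType.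
Implicit Types a b c : laurent k.

Lemma laurentP a b : coef a =1 coef b -> a = b.
Proof.
case: a b => [f hf] [g hg] /= /funext fg; subst g.
by congr Laurent; exact: Prop_irrelevance.
Qed.

Lemma laurent0_subproof : exists N : int, forall l : int, N < l -> (0 : k) = 0.
Proof. by exists 0. Qed.
Definition laurent0 := Laurent laurent0_subproof.

Lemma laurent1_subproof :
  exists N : int, forall l : int, N < l -> (l == 0)%:R = 0 :> k.
Proof. by exists 0 => l l0; rewrite gt_eqF. Qed.
Definition laurent1 := Laurent laurent1_subproof.

Lemma laurentN_subproof a : exists N : int, forall l : int, N < l -> - a l = 0.
Proof. by have [N aN] := coef_bounded a; exists N => l /aN ->; rewrite oppr0. Qed.
Definition laurentN a := Laurent (laurentN_subproof a).

Lemma laurentD_subproof a b :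
  exists N : int, forall l : int, N < l -> a l + b l = 0.
Proof.
have [N aN] := coef_bounded a; have [M bM] := coef_bounded b.
exists (Num.max N M) => l; rewrite gt_max => /andP[/aN -> /bM ->].
by rewrite addr0.
Qed.
Definition laurentD a b := Laurent (laurentD_subproof a b).

(* All but finitely many terms of the sum vanish. *)
Definition mul_coef a b (m : int) : k :=
  \sum_(i \in [set: int]) a i * b (m - i).

Lemma mul_coefE a b (N M : int) (j : nat) :
  (forall l : int, N < l -> a l = 0) -> (forall l : int, M < l -> b l = 0) ->
  mul_coef a b (N + M - j%:Z) =
  \sum_(i < j.+1) a (N - i%:Z) * b (M - (j - i)%N%:Z).
Proof.
move=> aN bM; rewrite /mul_coef.
pose r := [seq N - i%:Z | i <- iota 0 j.+1].
rewrite (fsbigE r)//.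
- rewrite (eq_bigl xpredT) => [|i]; last by rewrite in_setT.
  rewrite big_map -[iota _ _]/(index_iota 0 j.+1) big_mkord.
  apply: eq_bigr => i _; congr (_ * b _); have := ltn_ord i; lia.
- by rewrite map_inj_uniq ?iota_uniq// => x y; lia.
- move=> i _ ir; have [/aN ->|iN] := ltP N i; first by rewrite mul0r.
  rewrite (bM (_ - _)) ?mulr0// ltNge; apply: contra ir => h.
  apply/mapP; exists (absz (N - i)%R); last by lia.
  by rewrite mem_iota; lia.
Qed.

Lemma mul_coef_gt a b (N M m : int) :
  (forall l : int, N < l -> a l = 0) -> (forall l : int, M < l -> b l = 0) ->
  N + M < m -> mul_coef a b m = 0.
Proof.
move=> aN bM NMm; rewrite /mul_coef fsbig1// => i _.
have [/aN ->|iN] := ltP N i; first by rewrite mul0r.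
by rewrite (bM (_ - _)) ?mulr0//; lia.
Qed.

Lemma laurentM_subproof a b :
  exists N : int, forall l : int, N < l -> mul_coef a b l = 0.
Proof.
have [N aN] := coef_bounded a; have [M bM] := coef_bounded b.
by exists (N + M) => l; exact: mul_coef_gt.
Qed.
Definition laurentM a b := Laurent (laurentM_subproof a b).

Let trunc (N : int) (K : nat) (f : int -> k) : {poly k} :=
  \poly_(i < K) f (N - i%:Z).

Let mul_coef_poly a b (N M : int) (j K : nat) :
  (forall l : int, N < l -> a l = 0) -> (forall l : int, M < l -> b l = 0) ->
  (j < K)%N ->
  mul_coef a b (N + M - j%:Z) = (trunc N K a * trunc M K b)`_j.
Proof.
move=> aN bM jK; rewrite (mul_coefE _ aN bM) coefM; apply: eq_bigr => i _.
by rewrite !coef_poly !ifT//; have := ltn_ord i; lia.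
Qed.

Let coefM_agree (p q r : {poly k}) j :
  (forall i, (i <= j)%N -> p`_i = q`_i) -> (p * r)`_j = (q * r)`_j.
Proof.
move=> pq; rewrite !coefM; apply: eq_bigr => i _; rewrite pq//.
by rewrite -ltnS.
Qed.

Lemma laurentMC : commutative (@laurentM).
Proof.
move=> a b; apply: laurentP => m /=.
have [N aN] := coef_bounded a; have [M bM] := coef_bounded b.
have [h|h] := ltP (N + M) m.
  by rewrite (mul_coef_gt aN bM)// (mul_coef_gt bM aN)// addrC.
pose j := absz (N + M - m)%R.
rewrite [in LHS](_ : m = N + M - j%:Z); last by lia.
rewrite [in RHS](_ : m = M + N - j%:Z); last by lia.
by rewrite (mul_coef_poly aN bM (ltnSn _)) (mul_coef_poly bM aN (ltnSn _)) mulrC.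
Qed.

Lemma laurentMA : associative (@laurentM).
Proof.
move=> a b c; apply: laurentP => m /=.
have [N aN] := coef_bounded a; have [M bM] := coef_bounded b.
have [L cL] := coef_bounded c.
have abNM l : N + M < l -> laurentM a b l = 0 by exact: mul_coef_gt.
have bcML l : M + L < l -> laurentM b c l = 0 by exact: mul_coef_gt.
have [h|h] := ltP (N + M + L) m.
  by rewrite (mul_coef_gt aN bcML) ?addrA// (mul_coef_gt abNM cL).
pose j := absz (N + M + L - m)%R.
rewrite [in LHS](_ : m = N + (M + L) - j%:Z); last by lia.
rewrite [in RHS](_ : m = N + M + L - j%:Z); last by lia.
rewrite (mul_coef_poly aN bcML (ltnSn _)) (mul_coef_poly abNM cL (ltnSn _)).
have -> : (trunc (N + M) j.+1 (laurentM a b) * trunc L j.+1 c)`_j =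
          (trunc N j.+1 a * trunc M j.+1 b * trunc L j.+1 c)`_j.
  apply: coefM_agree => i ij; rewrite coef_poly ifT//.
  by rewrite /= (mul_coef_poly aN bM (K := j.+1)).
rewrite -mulrA mulrC [in RHS]mulrC; apply: coefM_agree => i ij.
by rewrite coef_poly ifT//= (mul_coef_poly bM cL (K := j.+1)).
Qed.

Lemma laurentM1 : left_id laurent1 (@laurentM).
Proof.
move=> a; apply: laurentP => m /=; rewrite /mul_coef.
rewrite (fsbigE [:: 0 : int])//=.
  by rewrite big_cons big_nil in_setT eqxx mul1r subr0 addr0.
by move=> i _; rewrite inE => /negPf /= ->; rewrite mul0r.
Qed.

Lemma laurentMDl : left_distributive (@laurentM) (@laurentD).
Proof.
move=> a b c; apply: laurentP => m /=.
have [N aN] := coef_bounded a; have [M bM] := coef_bounded b.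
have [L cL] := coef_bounded c.
pose K := Num.max N M.
have aK l : K < l -> a l = 0 by rewrite gt_max => /andP[/aN].
have bK l : K < l -> b l = 0 by rewrite gt_max => /andP[_ /bM].
have abK l : K < l -> laurentD a b l = 0 by move=> h; rewrite /= aK// bK// addr0.
have [h|h] := ltP (K + L) m.
  by rewrite (mul_coef_gt abK cL)// (mul_coef_gt aK cL)// (mul_coef_gt bK cL)// addr0.
rewrite (_ : m = K + L - (absz (K + L - m)%R)%:Z); last by lia.
rewrite (mul_coefE _ abK cL) (mul_coefE _ aK cL) (mul_coefE _ bK cL) -big_split.
by apply: eq_bigr => i _; rewrite /= mulrDl.
Qed.

Lemma laurent1_neq0 : laurent1 <> laurent0.
Proof.
move=> /(congr1 (fun a => coef a 0)) /= /eqP; exact/negP/oner_neq0.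
Qed.

Lemma laurentDA : associative laurentD.
Proof. by move=> a b c; apply: laurentP => l /=; rewrite addrA. Qed.

Lemma laurentDC : commutative laurentD.
Proof. by move=> a b; apply: laurentP => l /=; rewrite addrC. Qed.

Lemma laurentD0 : left_id laurent0 laurentD.
Proof. by move=> a; apply: laurentP => l /=; rewrite add0r. Qed.

Lemma laurentDN : left_inverse laurent0 laurentN laurentD.
Proof. by move=> a; apply: laurentP => l /=; rewrite addNr. Qed.

HB.instance Definition _ := GRing.isZmodule.Build (laurent k)
  laurentDA laurentDC laurentD0 laurentDN.

HB.instance Definition _ := GRing.Zmodule_isComNzRing.Build (laurent k)
  laurentMA laurentMC laurentM1 laurentMDl (introN eqP laurent1_neq0).

Definition is_deg a (l : int) := a l != 0 /\ forall m : int, l < m -> a m = 0.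

Lemma is_deg_exists a : a != 0 -> exists l, is_deg a l.
Proof.
move=> a0; have [N aN] := coef_bounded a.
have [l al] : exists l, a l != 0.
  apply: contrapT => h; move/eqP: a0; apply; apply: laurentP => l /=.
  by apply/eqP; apply: contrapT => /negP al; apply: h; exists l.
have lN : l <= N by rewrite leNgt; apply: contra al => /aN ->.
have ex : exists n : nat, a (N - n%:Z) != 0.
  by exists (absz (N - l)%R); rewrite (_ : _ - _ = l)//; lia.
case: (ex_minnP ex) => n an nmin; exists (N - n%:Z); split=> // m nm.
have [/aN//|mN] := ltP N m; apply/eqP; apply: contrapT => /negP am.
have := nmin (absz (N - m)%R); rewrite (_ : N - _ = m); last by lia.
by move=> /(_ am); lia.
Qed.

Lemma is_deg_unique a l m : is_deg a l -> is_deg a m -> l = m.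
Proof.
move=> [al la] [am ma]; have [lm|ml|//] := ltgtP l m.
  by rewrite (la _ lm) eqxx in am.
by rewrite (ma _ ml) eqxx in al.
Qed.

(* The leading exponent of a nonzero series; a junk value at 0. *)
Definition deg a : int := xget 0 [set l | is_deg a l].

Lemma degP a : a != 0 -> is_deg a (deg a).
Proof.
move=> /is_deg_exists[l al].
exact: (@xgetPex _ _ [set l | is_deg a l] (ex_intro _ l al)).
Qed.

Section Inverse.
Variable s : nat -> k.
Fixpoint inv_seq (n : nat) : seq k :=
  if n is m.+1 then
    let t := inv_seq m in
    rcons t ((s 0)^-1 * ((m == 0)%:R - \sum_(i < m) s (m - i)%N * t`_i))
  else [::].

Lemma size_inv_seq n : size (inv_seq n) = n.
Proof. by elim: n => //= n IH; rewrite size_rcons IH. Qed.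

Lemma nth_inv_seq n i : (i < n)%N -> (inv_seq n)`_i = (inv_seq i.+1)`_i.
Proof.
elim: n => // n IH; rewrite ltnS leq_eqVlt => /orP[/eqP ->//|ni].
by rewrite [LHS]/= nth_rcons size_inv_seq ni IH.
Qed.

Lemma nth_inv_seqE j : (inv_seq j.+1)`_j =
  (s 0)^-1 * ((j == 0)%:R - \sum_(i < j) s (j - i)%N * (inv_seq j)`_i).
Proof. by rewrite /= nth_rcons size_inv_seq ltnn eqxx. Qed.

Lemma inv_seqP (j : nat) : s 0 != 0 ->
  \sum_(i < j.+1) (inv_seq i.+1)`_i * s (j - i)%N = (j == 0)%:R.
Proof.
move=> s0; rewrite big_ord_recr [nat_of_ord ord_max]/= subnn nth_inv_seqE.
rewrite [(s 0)^-1 * _]mulrC -mulrA mulVf// mulr1.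
rewrite (eq_bigr (fun i : 'I_j => s (j - i)%N * (inv_seq j)`_i)) => [|i _].
  by rewrite [LHS]addrCA [X in _ + X]subrr addr0.
by rewrite mulrC (nth_inv_seq (ltn_ord i)).
Qed.
End Inverse.

Lemma laurent_inv_exists a : a != 0 -> exists b, b * a = 1.
Proof.
move=> /degP[]; set N := deg a => aN0 aN.
pose s (i : nat) := a (N - i%:Z).
pose f (l : int) : k :=
  if l <= - N then (inv_seq s (absz (- N - l)%R).+1)`_(absz (- N - l)%R) else 0.
have fN l : - N < l -> f l = 0 by rewrite /f ltNge => /negPf ->.
have hf : exists M : int, forall l : int, M < l -> f l = 0 by exists (- N).
exists (Laurent hf); apply: laurentP => m.
have fN' l : - N < l -> Laurent hf l = 0 by exact: fN.
change (mul_coef (Laurent hf) a m = (m == 0)%:R); have [h|h] := ltP (- N + N) m.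
  by rewrite (mul_coef_gt fN' aN)// gt_eqF//; lia.
pose j := absz (m)%R.
rewrite (_ : m = - N + N - j%:Z); last by lia.
rewrite (mul_coefE _ fN' aN) (_ : (_ == _) = (j == 0)%N); last by lia.
rewrite -(@inv_seqP s) ?/s ?subr0//; apply: eq_bigr => i _ /=.
rewrite /f ifT; last by lia.
by rewrite (_ : absz _ = i :> nat)//; lia.
Qed.

Definition laurent_inv a : laurent k :=
  if a == 0 then 0 else xget 0 [set b | b * a = 1].

Lemma laurent_mulVf a : a != 0 -> laurent_inv a * a = 1.
Proof.
move=> a0; rewrite /laurent_inv (negPf a0).
have [b ab] := laurent_inv_exists a0.
exact: (@xgetPex _ _ [set b | b * a = 1] (ex_intro _ b ab)).
Qed.

Lemma laurent_inv0 : laurent_inv 0 = 0.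
Proof. by rewrite /laurent_inv eqxx. Qed.

HB.instance Definition _ := GRing.ComNzRing_isField.Build (laurent k)
  laurent_mulVf laurent_inv0.

End LaurentField.

Definition absv (R : realType) (k : fieldType) (a : laurent k) : R :=
  if a == 0 then 0 else expR (deg a)%:~R.
Arguments absv R {k} a.

Section AbsoluteValue.
Variables (R : realType) (k : fieldType).
Implicit Types a b : laurent k.

Lemma absv0 : absv R (0 : laurent k) = 0.
Proof. by rewrite /absv eqxx. Qed.

Lemma absv_ge0 a : 0 <= absv R a.
Proof. by rewrite /absv; case: ifP => // _; exact: expR_ge0. Qed.

Lemma absv_eq0 a : absv R a = 0 -> a = 0.
Proof.
by rewrite /absv; case: eqP => // _ /eqP; rewrite gt_eqF// expR_gt0.
Qed.

Lemma absvN a : absv R (- a) = absv R a.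
Proof.
rewrite /absv oppr_eq0; case: eqVneq => // a0; congr (expR _%:~R).
have [da ad] := degP a0; apply: (@is_deg_unique _ (- a)).
  by apply: degP; rewrite oppr_eq0.
by split=> [|m /ad]; rewrite /= ?oppr_eq0// => ->; rewrite oppr0.
Qed.

Lemma absv_ge a (l : int) : a l != 0 -> expR l%:~R <= absv R a.
Proof.
move=> al; have a0 : a != 0 by apply: contraNneq al => ->.
rewrite /absv (negPf a0) ler_expR ler_int leNgt.
by apply: contra al => /(degP a0).2 ->.
Qed.

Lemma absvD a b : absv R (a + b) <= Num.max (absv R a) (absv R b).
Proof.
rewrite {1}/absv; case: eqVneq => [_|/degP[dab _]].
  by rewrite le_max absv_ge0.
rewrite le_max; have [al|/absv_ge->//] := eqVneq (coef a (deg (a + b))) 0.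
by rewrite orbC absv_ge//; apply: contraNneq dab => bl; rewrite /= al bl addr0.
Qed.

End AbsoluteValue.

(* k((X^-1)) as a metric space; R only records where distances take values. *)
Definition lfield (R : realType) (k : fieldType) : Type := laurent k.

Section Metric.
Variables (R : realType) (k : fieldType).

HB.instance Definition _ := GRing.Field.on (lfield R k).
HB.instance Definition _ := isPointed.Build (lfield R k) 0.

Let mdist (a b : lfield R k) : R := absv R (a - b).

Let mdistxx a : mdist a a = 0.
Proof. by rewrite /mdist subrr absv0. Qed.

Let mdist_positivity a b : mdist a b = 0 -> a = b.
Proof. by move=> /absv_eq0/eqP; rewrite subr_eq0 => /eqP. Qed.

Let mdist_sym a b : mdist a b = mdist b a.
Proof. by rewrite /mdist -absvN opprB. Qed.

Let mdist_triangle b a c : mdist a c <= mdist a b + mdist b c.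
Proof.
rewrite /mdist -(subrKA b) (le_trans (absvD _ _ _))// ge_max.
by rewrite lerDl lerDr !absv_ge0.
Qed.

HB.instance Definition _ := isMetric.Build R (lfield R k)
  mdistxx mdist_positivity mdist_sym mdist_triangle.

End Metric.

Section Measures.
Variables (R : realType) (k : fieldType) (n : nat).
Local Notation F := (lfield R k).
Local Notation Fn := 'rV[F]_n.

Definition supnorm (v : Fn) : R := \big[Num.max/0]_(i < n) absv R (v 0 i).

(* The library's balls of ['rV[F]_n] are the open balls of the sup norm. *)
Lemma ball_supnorm (x y : Fn) (r : R) :
  0 < r -> ball x r y <-> supnorm (x - y) < r.
Proof.
move=> r0; split.
  move=> [_ xy]; apply/bigmax_ltP; split=> // i _.
  by have := xy 0 i; rewrite ballEmdist /= !mxE.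
move=> /bigmax_ltP[_ xy]; split=> // i j; rewrite ord1 ballEmdist /=.
by have := xy j isT; rewrite !mxE.
Qed.

Definition dist (y : Fn) (A : set Fn) : R := inf [set supnorm (y - a) | a in A].

Definition thickening (A : set Fn) (e : R) : set Fn := [set y | dist y A < e].

Definition affine_plane (d : nat) (L : set Fn) :=
  exists (p : Fn) (W : {vspace Fn}),
    \dim W = d /\ L = [set p + w | w in [set` W]].

Definition affine_hyperplane := affine_plane n.-1.

Definition borelType := g_sigma_algebraType (@open Fn).

Local Notation borel_measure := {measure set borelType -> \bar R}.
Implicit Type mu : borel_measure.

Definition supp mu : set Fn :=
  \bigcap_(C in [set C : set Fn | closed C /\ mu (~` C) = 0%E]) C.

Definition non_atomic mu := forall y : Fn, mu [set y] = 0%E.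

Definition doubling mu := exists c : R, 0 < c /\
  forall (y : Fn) (r : R), supp mu y -> 0 < r ->
    (mu (ball y (2 * r)) <= c%:E * mu (ball y r))%E.

Definition non_planar mu := forall L, affine_hyperplane L -> mu L = 0%E.

Definition dist_norm mu (L B : set Fn) : R :=
  sup [set dist y L | y in supp mu `&` B].

(* When [dist_norm mu L B = 0] the bound is e / 0 = +oo, so it says nothing;
   the guard is needed because x / 0 = 0 in MathComp. *)
Definition decaying mu (C alpha : R) (V : set Fn) :=
  forall (y : Fn) (r : R), supp mu y -> 0 < r -> ball y r `<=` V ->
  forall L, affine_hyperplane L -> forall e : R, 0 < e ->
  0 < dist_norm mu L (ball y r) ->
  (mu (ball y r `&` thickening L e) <=
    (C * (e / dist_norm mu L (ball y r)) `^ alpha)%:E * mu (ball y r))%E.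

Lemma open_borel (V : set Fn) : open V -> measurable (V : set borelType).
Proof. by move=> oV; exact: sub_sigma_algebra. Qed.

Definition friendly mu := non_atomic mu /\
  {ae mu, forall y0, exists (V : set Fn) (oV : open V),
    let nu := mrestr mu (open_borel oV) in
    [/\ V y0, fin_num_fun nu, doubling nu, non_planar nu &
        exists C alpha : R, [/\ 0 < C, 0 < alpha & decaying nu C alpha V]]}.

Definition contracting (d : nat) mu :=
  [/\ fin_num_fun mu, non_atomic mu, doubling mu &
  exists C alpha r0 : R, [/\ 0 < C, 0 < alpha, 0 < r0 &
    forall L, affine_plane d L ->
    forall e delta : R, 0 < e < r0 -> 0 < delta < 1 ->
    forall y, thickening L (delta * e) y -> supp mu y ->
    exists r : R, [/\ 0 < r,
      ball y r `&` supp mu `<=` thickening L e &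
      (mu (ball y (5 * r) `&` thickening L (delta * e)) <=
        (C * delta `^ alpha)%:E * mu (ball y (5 * r)))%E]]].

Definition contracting_ae (d : nat) mu :=
  {ae mu, forall y0, exists (V : set Fn) (oV : open V),
    V y0 /\ contracting d (mrestr mu (open_borel oV))}.

End Measures.

(* Main.v *)
Require Import Defs.
From mathcomp Require Import all_boot all_order all_algebra.
From mathcomp Require Import all_classical all_reals all_analysis.
From mathcomp Require Import ring lra zify.

Set Implicit Arguments.
Unset Strict Implicit.
Unset Printing Implicit Defensive.

Import Order.TTheory GRing.Theory Num.Theory.
Import numFieldNormedType.Exports.

Local Open Scope classical_set_scope.
Local Open Scope ring_scope.

(* Around a point of the support, restrict the measure to a small ball U, which
   is clopen since the metric is ultrametric. The support S of the restriction
   lies in no hyperplane, so it is uniformly far from all d-planes. Given y in S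
   close to a d-plane L, shrink U around y by factors of 5 down to the first ball
   B with B `&` S in the e-thickening of L; then 5B contains a point x of S at
   distance at least e from L. A hyperplane H containing L and still at distance
   at least e from x exists by a non-Archimedean Hahn-Banach argument, and the
   decay of the measure near H on 5B gives the contraction near L. *)

(** * Multiplicativity of the absolute value *)

Section AbsoluteValue.
Variables (R : realType) (k : fieldType).
Implicit Types a b : laurent k.

Lemma is_degE a (l : int) : is_deg a l -> absv R a = expR l%:~R.
Proof.
move=> al; have a0 : a != 0 by case: al => al _; apply: contraNneq al => ->.
by rewrite /absv (negPf a0) (is_deg_unique (degP a0) al).
Qed.

Lemma absvM a b : absv R (a * b) = absv R a * absv R b.
Proof.
have [->|a0] := eqVneq a 0; first by rewrite mul0r absv0 mul0r.
have [->|b0] := eqVneq b 0; first by rewrite mulr0 absv0 mulr0.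
have [aN Na] := degP a0; have [bM Mb] := degP b0.
rewrite (is_degE (degP a0)) (is_degE (degP b0)) -expRD -intrD.
apply: is_degE; split; last by move=> m; exact: mul_coef_gt.
have := mul_coefE 0 Na Mb; rewrite subr0 big_ord1 !subr0 => h.
change (mul_coef a b (deg a + deg b) != 0).
by rewrite h mulf_eq0 negb_or aN.
Qed.

Lemma absv_le a (M : int) :
  (forall l : int, M < l -> a l = 0) -> absv R a <= expR M%:~R.
Proof.
move=> aM; rewrite /absv; case: eqVneq => [_|/degP[da _]]; first exact: expR_ge0.
rewrite ler_expR ler_int leNgt; apply: contra da => /aM ->; exact: eqxx.
Qed.

Lemma absvV a : a != 0 -> absv R a^-1 = (absv R a)^-1.
Proof.
move=> a0; have aR0 : absv R a != 0 by apply: contra_neq a0; exact: absv_eq0.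
apply: (mulfI aR0); rewrite mulfV// -absvM mulfV//.
have one1 : is_deg (1 : laurent k) 0.
  by split=> [|m m0] /=; rewrite ?eqxx ?oner_neq0// gt_eqF.
by rewrite (is_degE one1) expR0.
Qed.

End AbsoluteValue.

(** * The sup norm as an ultrametric norm *)

Section SupNorm.
Variables (R : realType) (k : fieldType) (n : nat).
Local Notation F := (lfield R k).
Local Notation Fn := 'rV[F]_n.
Implicit Types (v w x y z : Fn) (c : F).

Lemma supnorm_ge0 v : 0 <= supnorm v.
Proof. exact: bigmax_ge_id. Qed.

Lemma absv_le_supnorm v i : absv R (v 0 i) <= supnorm v.
Proof. exact: (le_bigmax _ (fun i => absv R (v 0 i))). Qed.

Lemma supnorm_le v (M : R) :
  0 <= M -> (forall i, absv R (v 0 i) <= M) -> supnorm v <= M.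
Proof. by move=> M0 vM; apply/bigmax_leP; split. Qed.

Lemma supnorm0 : supnorm (0 : Fn) = 0.
Proof.
apply/eqP; rewrite eq_le supnorm_ge0 andbT; apply: supnorm_le => // i.
by rewrite mxE absv0.
Qed.

Lemma supnorm_eq0 v : supnorm v = 0 -> v = 0.
Proof.
move=> v0; apply/rowP => i; rewrite mxE; apply: (@absv_eq0 R).
by apply/eqP; rewrite eq_le absv_ge0 andbT -v0; exact: absv_le_supnorm.
Qed.

Lemma supnorm_gt0 v : v != 0 -> 0 < supnorm v.
Proof.
move=> v0; rewrite lt_def supnorm_ge0 andbT.
by apply: contra_neq v0; exact: supnorm_eq0.
Qed.

Lemma supnorm_attained v : v != 0 -> exists i, absv R (v 0 i) = supnorm v.
Proof.
move=> v0; have [i _|n0] := pickP 'I_n; last first.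
  by case/eqP: v0; apply/rowP => i; have := n0 i.
have [j _ h] := @eq_bigmax _ _ _ (0 : R) i xpredT (fun i => absv R (v 0 i)) isT
  (fun j _ => absv_ge0 R (v 0 j)).
by exists j; rewrite -h.
Qed.

Lemma supnormN v : supnorm (- v) = supnorm v.
Proof. by apply: eq_bigr => i _; rewrite mxE; exact: absvN. Qed.

Lemma supnormD v w : supnorm (v + w) <= Num.max (supnorm v) (supnorm w).
Proof.
apply: supnorm_le => [|i]; first by rewrite le_max supnorm_ge0.
rewrite mxE; apply: le_trans (absvD _ _ _) _.
by rewrite ge_max !le_max !absv_le_supnorm orbT.
Qed.

Lemma supnormB v w : supnorm (v - w) <= Num.max (supnorm v) (supnorm w).
Proof. by rewrite -(supnormN w); exact: supnormD. Qed.

Lemma supnormZ c v : supnorm (c *: v) = absv R c * supnorm v.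
Proof.
apply/eqP; rewrite eq_le; apply/andP; split.
  apply: supnorm_le => [|i]; first by rewrite mulr_ge0 ?absv_ge0 ?supnorm_ge0.
  by rewrite mxE [absv _ _]absvM ler_wpM2l ?absv_ge0 ?absv_le_supnorm.
have [->|v0] := eqVneq v 0; first by rewrite scaler0 supnorm0 mulr0.
have [i <-] := supnorm_attained v0; rewrite -absvM.
by have := absv_le_supnorm (c *: v) i; rewrite mxE.
Qed.

Lemma subBB x y z : (x - z) - (x - y) = y - z.
Proof. by rewrite opprB [LHS]addrC subrKA. Qed.

Lemma supnormB_lt v w (r : R) :
  supnorm v < r -> supnorm w < r -> supnorm (v - w) < r.
Proof. by move=> vr wr; rewrite (le_lt_trans (supnormB _ _))// gt_max vr. Qed.

(** Vectors of norm less than [r] are closed under subtraction, so every point of a ball is a centre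
    of it. *)
Lemma ball_shift x y z (r : R) :
  0 < r -> ball x r y -> ball x r z -> ball y r z.
Proof.
move=> r0 /(ball_supnorm _ _ r0) xy /(ball_supnorm _ _ r0) xz.
apply/(ball_supnorm _ _ r0).
rewrite -(subBB x).
exact: supnormB_lt.
Qed.

Lemma ball_eq x y (r : R) : 0 < r -> ball x r y -> ball y r = ball x r.
Proof.
move=> r0 xy; apply/seteqP; split => z; last exact: ball_shift.
by apply: ball_shift => //; exact: ball_sym.
Qed.

Lemma open_rowP (U : set Fn) :
  open U <-> forall x, U x -> exists2 r : R, 0 < r & ball x r `<=` U.
Proof.
rewrite openE; split=> [oU x /oU /nbhs_ballP[r r0 xr]|h x /h[r r0 xr]].
  by exists r.
by apply/nbhs_ballP; exists r.
Qed.

Lemma open_ball_row x (r : R) : 0 < r -> open (ball x r).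
Proof.
move=> r0; apply/open_rowP => y xy; exists r; first exact: r0.
by rewrite (ball_eq r0 xy).
Qed.

(** Balls of equal radius are equal or disjoint, so the complement is a union of balls of radius
    [r]. *)
Lemma closed_ball_row x (r : R) : 0 < r -> closed (ball x r).
Proof.
move=> r0; rewrite -openC; apply/open_rowP => y xy; exists r; first exact: r0.
move=> z yz xz; apply: xy; rewrite -(ball_eq r0 xz); exact: ball_sym.
Qed.

End SupNorm.

(** * Projections along subspaces and kernels of linear forms *)

Section Projections.
Variables (R : realType) (k : fieldType) (n : nat).
Local Notation F := (lfield R k).
Local Notation Fn := 'rV[F]_n.

(* Non-Archimedean orthogonal projection along [W]. One vector [w] of [W] is
   eliminated at a time, using a coordinate [i] at which [w] attains its norm
   as pivot, so that [v - (v_i / w_i) w] is no longer than [v]. *)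
Lemma orth_proj (W : {vspace Fn}) : exists Q : 'M[F]_n,
  [/\ forall w, w \in W -> w *m Q = 0, forall v, v - v *m Q \in W &
      forall v : Fn, supnorm (v *m Q) <= supnorm v].
Proof.
rewrite -(span_basis (vbasisP W)).
elim: (tval (vbasis W)) => [|x X [Q1 [Q1X Q1v Q1le]]].
  exists 1%:M; split=> [w|v|v]; rewrite ?mulmx1 ?span_nil ?subrr ?mem0v//.
  by rewrite memv0 => /eqP.
rewrite span_cons; have [xQ0|xQ0] := eqVneq (x *m Q1) 0.
  exists Q1; split=> [w|v|//].
    case/memv_addP => _ /vlineP[c ->] [u uX ->].
    by rewrite mulmxDl -scalemxAl xQ0 scaler0 (Q1X u)// addr0.
  by apply: subvP (Q1v v); exact: addvSr.
set w1 := x *m Q1 in xQ0; have [i wi] := supnorm_attained xQ0.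
have wi0 : w1 0 i != 0.
  by apply: contra_neq xQ0 => h; apply: supnorm_eq0; rewrite -wi h absv0.
pose Q := Q1 - (w1 0 i)^-1 *: (col i Q1 *m w1).
have QE v : v *m Q = v *m Q1 - ((v *m Q1) 0 i / w1 0 i) *: w1.
  rewrite mulmxBr -scalemxAr (mulmxA v _ w1) colE mulmxA -colE.
  rewrite (_ : col i (v *m Q1) = ((v *m Q1) 0 i)%:M); last first.
    by apply/matrixP => a b; rewrite !ord1 !mxE.
  by rewrite mul_scalar_mx scalerA [_^-1 * _]mulrC.
exists Q; split=> [w|v|v]; rewrite QE.
- case/memv_addP => _ /vlineP[c ->] [u uX ->].
  rewrite mulmxDl -scalemxAl -/w1 (Q1X u)// addr0 mxE mulfK//.
  exact: subrr.
- rewrite opprB addrCA addrC; apply: rpredD.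
    by apply: subvP (Q1v v); exact: addvSr.
  apply: rpredZ; rewrite -(subKr x w1); apply: rpredB.
    by apply: subvP (memv_line x); exact: addvSl.
  by apply: subvP (Q1v x); exact: addvSr.
- rewrite (le_trans (supnormB _ _))// ge_max Q1le/= supnormZ.
  rewrite [absv _ _]absvM absvV// -wi mulfVK; last first.
    by apply: contra_neq wi0; exact: absv_eq0.
  by rewrite (le_trans _ (Q1le v))// absv_le_supnorm.
Qed.

(** Rank-nullity: a nonzero form has an image of dimension 1, hence a kernel of dimension [n.-1]. *)
Lemma affine_hyperplane_col (f : 'cV[F]_n) (p : Fn) :
  f != 0 -> affine_hyperplane [set y : Fn | (y - p) *m f = 0].
Proof.
move=> f0; pose g : 'Hom(Fn, 'M[F]_(1, 1)) := linfun (mulmxr f).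
have gE v : g v = v *m f by rewrite lfunE.
exists p, (lker g); split; last first.
  apply/seteqP; split => [y /= yf|_ [w /= wg <-]].
    by exists (y - p); [rewrite /= memv_ker gE yf | rewrite addrC subrK].
  by rewrite addrC addKr; move: wg; rewrite memv_ker gE => /eqP.
have /eqP := limg_ker_dim g fullv; rewrite capfv dimvf dim_matrix mul1r.
have : (\dim (limg g) <= 1)%N.
  by rewrite (leq_trans (dimvS (subvf _)))// dimvf dim_matrix.
have : \dim (limg g) != 0%N.
  rewrite dimv_eq0; apply: contra_neq f0 => g0; apply/colP => i; rewrite mxE.
  have : g 'e_i \in limg g by exact: memv_img (memvf _).
  by rewrite g0 memv0 gE -rowE => /eqP/rowP/(_ 0); rewrite !mxE.
by case: (\dim (limg g)) => [//|[|//]] _ _ /eqP/(congr1 predn); rewrite addn1.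
Qed.

End Projections.

(** * Distances to sets and separation by hyperplanes *)

Section Thickenings.
Variables (R : realType) (k : fieldType) (n : nat).
Local Notation F := (lfield R k).
Local Notation Fn := 'rV[F]_n.
Implicit Types (x y z a : Fn) (L A : set Fn).

Lemma dist_le y A a : A a -> dist y A <= supnorm (y - a).
Proof.
move=> Aa; apply: ge_inf; last by exists a.
by exists 0 => _ [b _ <-]; exact: supnorm_ge0.
Qed.

Lemma le_dist y A (m : R) :
  A !=set0 -> (forall a, A a -> m <= supnorm (y - a)) -> m <= dist y A.
Proof.
move=> [a Aa] h; apply: lb_le_inf; first by exists (supnorm (y - a)), a.
by move=> _ [b Ab <-]; exact: h.
Qed.

Lemma dist_lt y A (e : R) :
  A !=set0 -> dist y A < e -> exists2 a, A a & supnorm (y - a) < e.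
Proof.
move=> [a Aa] h; have [|_ [b Ab <-] be] := inf_lt _ h; last by exists b.
by exists (supnorm (y - a)), a.
Qed.

Lemma dist_subset y L A : L !=set0 -> L `<=` A -> dist y A <= dist y L.
Proof. by move=> L0 LA; apply: le_dist => // a /LA; exact: dist_le. Qed.

(** Two distances below [e] compose to one below [e], with no loss in the radius. *)
Lemma ball_thickening y A (e : R) :
  A !=set0 -> thickening A e y -> ball y e `<=` thickening A e.
Proof.
move=> A0 ye z yz.
have [a Aa ya] := dist_lt A0 ye.
have e0 : 0 < e by exact: le_lt_trans (supnorm_ge0 _) ya.
apply: (le_lt_trans (dist_le _ Aa)); rewrite -(subBB y).
exact: (supnormB_lt ya (iffLR (ball_supnorm _ _ e0) yz)).
Qed.

Lemma open_thickening A (e : R) : A !=set0 -> open (thickening A e).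
Proof.
move=> A0; apply/open_rowP => y ye; exists e; last exact: ball_thickening.
by have [a _ /(le_lt_trans (supnorm_ge0 _))] := dist_lt A0 ye.
Qed.

Lemma dist_norm_ge (mu : {measure set (borelType R k n) -> \bar R}) L x y (r : R) :
  L !=set0 -> 0 < r -> supp mu x -> ball y r x ->
  dist x L <= dist_norm mu L (ball y r).
Proof.
move=> [a La] r0 Sx xB; apply: ub_le_sup; last by exists x.
(* [sup] takes a default value on unbounded sets, so a bound is required: every point of the ball is
   within this maximum of the point [a] of [L]. *)
exists (Num.max r (supnorm (y - a))) => _ [z [_ yz] <-].
apply: (le_trans (dist_le z La)); rewrite -(subBB y).
apply: (le_trans (supnormB _ _)); rewrite maxC le_max2//.
by have /(ball_supnorm _ _ r0)/ltW := yz.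
Qed.

(** Subtracting [w] from [x - p] does not change its image under [Q], and [Q] does not increase
    norms. *)
Lemma proj_le_dist (W : {vspace Fn}) (Q : 'M[F]_n) p x :
  (forall w, w \in W -> w *m Q = 0) ->
  (forall v : Fn, supnorm (v *m Q) <= supnorm v) ->
  supnorm ((x - p) *m Q) <= dist x [set p + w | w in [set` W]].
Proof.
move=> QW Qle; apply: le_dist => [|_ [w /= wW <-]].
  by exists (p + 0), 0 => //=; exact: mem0v.
have <- : (x - (p + w)) *m Q = (x - p) *m Q.
  by rewrite opprD addrA (mulmxBl (x - p)) (QW w wW) subr0.
exact: Qle.
Qed.

(* The row [j] of the orthogonal projection at which [x - p] attains its norm
   is a linear form of norm at most 1 vanishing on [L - p]: a
   Hahn-Banach separation of [x] from [L]. *)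
Lemma hyperplane_through_plane d L x (e : R) :
  affine_plane d L -> 0 < e -> e <= dist x L ->
  exists2 H, affine_hyperplane H & L `<=` H /\ e <= dist x H.
Proof.
move=> [p [W [_ ->]]] e0 eL; have [Q [QW Qv Qle]] := orth_proj W.
(* [(x - p) - (x - p) *m Q] lies in [W]; translated by [p], it is a point of [L] at distance
   [supnorm ((x - p) *m Q)] from [x]. *)
have exQ : e <= supnorm ((x - p) *m Q).
  apply: (le_trans eL); 
  rewrite [leRHS](_ : _ = supnorm (x - (p + ((x - p) - (x - p) *m Q)))); last first.
    by rewrite opprD addrA subKr.
  by apply: dist_le; exists ((x - p) - (x - p) *m Q) => //=; exact: Qv.
have [j je] : exists j, absv R (((x - p) *m Q) 0 j) = supnorm ((x - p) *m Q).
  apply: supnorm_attained; apply: contraTneq exQ => ->.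
  by rewrite supnorm0 -ltNge.
have fE v : (v *m col j Q) 0 0 = (v *m Q) 0 j.
  by rewrite colE mulmxA -colE mxE.
exists [set y | (y - p) *m col j Q = 0].
  apply: affine_hyperplane_col; apply: contraTneq exQ => f0; rewrite -ltNge -je.
  by rewrite -fE f0 mulmx0 mxE absv0.
split=> [_ [w /= wW <-]|].
  by apply/matrixP => i l; rewrite !ord1 [p + w]addrC addrK fE QW// !mxE.
have Qj_le (u v : Fn) : (v *m Q) 0 j = 0 -> absv R ((u *m Q) 0 j) <= supnorm (u - v).
  move=> v0; apply: le_trans (Qle _); apply: le_trans (absv_le_supnorm _ j).
  by rewrite mulmxBl [in leRHS]mxE [X in _ + X]mxE v0 subr0.
apply: le_dist => [|a /= af]; first by exists p => /=; rewrite subrr mul0mx.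
have := Qj_le (x - p) (a - p); rewrite -fE af mxE je => /(_ erefl).
rewrite opprB addrA subrK; exact: le_trans.
Qed.

End Thickenings.

(** * Countably many balls suffice to detect null sets *)

Section Separability.
Variables (R : realType) (k : finFieldType) (n : nat).
Local Notation F := (lfield R k).
Local Notation Fn := 'rV[F]_n.

Lemma laurent_poly_bounded (q : int * seq k) :
  exists N : int, forall l : int, N < l ->
    (if l <= q.1 then q.2`_(absz (q.1 - l)%R) else 0) = 0.
Proof. by exists q.1 => l; rewrite ltNge => /negPf ->. Qed.
(** A finite series, coded by a bound on its exponents and its coefficients in descending order; as
    [k] is finite, the codes form a countable type. *)
Definition laurent_poly (q : int * seq k) : F := Laurent (laurent_poly_bounded q).

Lemma laurent_poly_dense (a : F) (e : R) :
  0 < e -> exists q, absv R (a - laurent_poly q) < e.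
Proof.
move=> e0; have [N aN] := coef_bounded (a : laurent k).
pose j := Num.Def.archi_bound e^-1.
have je : e^-1 < j%:R by apply: archi_boundP; rewrite invr_ge0 ltW.
(* Enough terms to descend from [N] to the exponent [-j]. The error is then at most [expR (-j)],
   which is below [e] since [expR j >= 1 + j > e^-1]. *)
pose K := (absz (N + j%:Z)%R).+1.
exists (N, mkseq (fun i => coef a (N - i%:Z)) K).
apply: (@le_lt_trans _ _ (expR (- j%:Z)%:~R)); last first.
  rewrite mulrNz expRN invf_plt ?posrE ?expR_gt0//; apply: (lt_le_trans je).
  rewrite pmulrn; apply: le_trans (expR_ge1Dx _); by rewrite lerDr.
apply: absv_le => l jl /=; case: (leP l N) => lN; last by rewrite (aN _ lN) oppr0 addr0.
rewrite nth_mkseq; last by rewrite /K; lia.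
by rewrite (_ : N - _ = l) ?subrr//; lia.
Qed.

Definition center (q : 'rV[int * seq k]_n) : Fn := \row_i laurent_poly (q 0 i).

Lemma center_dense (x : Fn) (e : R) : 0 < e -> exists q, ball (center q) e x.
Proof.
move=> e0; have /choice[f fP] : forall i, exists q, absv R (x 0 i - laurent_poly q) < e.
  by move=> i; exact: laurent_poly_dense.
exists (\row_i f i); apply: ball_sym; apply/(ball_supnorm _ _ e0).
by apply/bigmax_ltP; split=> // i _; rewrite !mxE.
Qed.

(** A Lindelof argument: each point lies in a null ball with coded centre and radius [j.+1%:R^-1],
    and such balls are countably many. *)
Lemma locally_negligible (mu : {measure set (borelType R k n) -> \bar R}) (U : set Fn) :
  (forall x, U x -> exists V : set Fn, [/\ open V, V x & mu V = 0%E]) ->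
  mu.-negligible (U : set (borelType R k n)).
Proof.
move=> UV.
pose B (c : 'rV[int * seq k]_n * nat) : set Fn := ball (center c.1) c.2.+1%:R^-1.
pose G (i : nat) : set (borelType R k n) :=
  if unpickle i is Some c then if `[< mu (B c) = 0%E >] then B c else set0 else set0.
apply: (@negligibleS _ _ _ _ (\bigcup_i G i)).
  move=> x /UV[V [oV Vx V0]].
  have [r r0 xrV] := iffLR (open_rowP V) oV x Vx.
  pose j := Num.Def.archi_bound r^-1.
  have jr : j.+1%:R^-1 <= r.
    rewrite invf_ple ?posrE// ltW// (lt_trans (archi_boundP _))// ?ltr_nat//.
    by rewrite invr_ge0 ltW.
  have j0 : 0 < j.+1%:R^-1 :> R by rewrite invr_gt0.
  have [q qx] := center_dense x j0.
  (* Since [x] lies in this ball, it is also a centre of it, and the radius is at most [r]. *)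
  have BV : B (q, j) `<=` V.
    by rewrite /B -(ball_eq j0 qx); apply: subset_trans xrV; exact: le_ball.
  exists (pickle (q, j)) => //; rewrite /G pickleK ifT//.
  apply/asboolP/eqP; rewrite eq_le measure_ge0 andbT -V0.
  by apply: le_measure; rewrite ?inE//; apply: open_borel => //; exact: open_ball_row.
apply: negligible_bigcup => i; rewrite /G.
case: unpickle => [c|]; last exact: negligible_set0.
case: asboolP => [c0|_]; last exact: negligible_set0.
exists (B c); split=> //; apply: open_borel; exact: open_ball_row.
Qed.

End Separability.

(** * Supports of measures and of their restrictions *)

Section Support.
Variables (R : realType) (k : fieldType) (n : nat).
Local Notation F := (lfield R k).
Local Notation Fn := 'rV[F]_n.
Implicit Types (mu : {measure set (borelType R k n) -> \bar R}) (x : Fn) (U V : set Fn).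

Lemma measure_subset mu (A B : set (borelType R k n)) :
  measurable A -> measurable B -> A `<=` B -> (mu A <= mu B)%E.
Proof. by move=> mA mB AB; apply: le_measure; rewrite ?inE. Qed.

Lemma suppP mu x : supp mu x <-> forall U, open U -> U x -> mu U <> 0%E.
Proof.
split=> [Sx U oU Ux U0|h C [cC C0]].
  by have /(_ Ux) : (~` U) x by apply: Sx; split; [rewrite closedC | rewrite setCK].
by apply: contrapT => Cx; apply: (h (~` C)) => //; exact: closed_openC.
Qed.

Lemma closed_supp mu : closed (supp mu).
Proof. by apply: closed_bigI => C []. Qed.

Lemma supp_mrestr_subset mu U V (oU : open U) (oV : open V) : U `<=` V ->
  supp (mrestr mu (open_borel oU)) `<=` supp (mrestr mu (open_borel oV)).
Proof.
move=> UV x /suppP Sx; apply/suppP => B oB Bx B0; apply: (Sx B oB Bx).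
apply/eqP; rewrite eq_le measure_ge0 andbT -B0; apply: measure_subset.
- by apply: open_borel; exact: openI.
- by apply: open_borel; exact: openI.
- exact: setIS.
Qed.

(** [U] is itself a closed set of full measure for the restriction. *)
Lemma supp_mrestr_clopen mu U (oU : open U) : closed U ->
  supp (mrestr mu (open_borel oU)) `<=` U.
Proof. by move=> cU x; apply; split => //=; rewrite /mrestr setICl measure0. Qed.

End Support.

Lemma measure_suppC (R : realType) (k : finFieldType) (n : nat)
  (mu : {measure set (borelType R k n) -> \bar R}) : mu (~` supp mu) = 0%E.
Proof.
apply: measure_negligible.
  by apply: open_borel; rewrite openC; exact: closed_supp.
apply: locally_negligible => x /suppP; apply: contra_notP => h U oU Ux U0.
by apply: h; exists U.
Qed.

(** * Uniform distance from planes of a set lying in no hyperplane *)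

Section Scale.
Variables (R : realType) (k : fieldType) (n : nat).
Local Notation F := (lfield R k).
Local Notation Fn := 'rV[F]_n.

Lemma supnorm_sum (I : finType) (f : I -> Fn) (M : R) :
  0 <= M -> (forall i, supnorm (f i) <= M) -> supnorm (\sum_i f i) <= M.
Proof.
move=> M0 fM; apply: (big_ind (fun v : Fn => supnorm v <= M)) => //.
  by rewrite supnorm0.
by move=> u v uM vM; rewrite (le_trans (supnormD _ _))// ge_max uM.
Qed.

Lemma vspace_proper (W : {vspace Fn}) :
  (\dim W < n)%N -> exists v, v \notin W.
Proof.
move=> Wn; have /subvPn[v _ vW] : ~~ (fullv <= W)%VS; last by exists v.
apply: contraTN Wn => /dimvS; rewrite dimvf dim_matrix mul1r -leqNgt.
exact.
Qed.

(* The vectors whose image under every matrix [Q] is controlled by the images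
   of the differences [x - x0], [x] in [S], form a subspace containing these
   differences; [S] lying in no hyperplane, it is the whole space. *)
Lemma spanning_bound (S : set Fn) (x0 : Fn) : S x0 ->
  (forall H, affine_hyperplane H -> ~ S `<=` H) ->
  forall u : Fn, exists2 K : R, 0 < K & forall (Q : 'M[F]_n) (e : R),
    (forall x, S x -> supnorm ((x - x0) *m Q) <= e) -> supnorm (u *m Q) <= K * e.
Proof.
move=> Sx0 SH.
pose E (u : Fn) := exists2 K : R, 0 < K & forall (Q : 'M[F]_n) (e : R),
  (forall x, S x -> supnorm ((x - x0) *m Q) <= e) -> supnorm (u *m Q) <= K * e.
have e_ge0 (Q : 'M[F]_n) (e : R) :
    (forall x, S x -> supnorm ((x - x0) *m Q) <= e) -> 0 <= e.
  by move=> /(_ x0 Sx0); rewrite subrr mul0mx supnorm0.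
have ED u v : E u -> E v -> E (u + v).
  move=> [K K0 uK] [M M0 vM]; exists (K + M) => [|Q e h]; first exact: addr_gt0.
  have e0 := e_ge0 Q e h; rewrite mulmxDl (le_trans (supnormD _ _))// mulrDl ge_max.
  have Ke : 0 <= K * e by rewrite mulr_ge0// ltW.
  have Me : 0 <= M * e by rewrite mulr_ge0// ltW.
  apply/andP; split.
    by apply: (le_trans (uK Q e h)); rewrite lerDl.
  by apply: (le_trans (vM Q e h)); rewrite lerDr.
have EZ c u : E u -> E (c *: u).
  (* Adding 1 keeps the constant positive when [c = 0]. *)
  move=> [K K0 uK]; exists (absv R c * K + 1) => [|Q e h].
    by rewrite ltr_wpDl// mulr_ge0 ?absv_ge0// ltW.
  have e0 := e_ge0 Q e h; rewrite -scalemxAl supnormZ mulrDl mul1r -mulrA.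
  by rewrite (le_trans (ler_wpM2l (absv_ge0 _ _) (uK Q e h)))// lerDl.
have ES x : S x -> E (x - x0).
  by move=> Sx; exists 1 => // Q e h; rewrite mul1r; exact: h.
(* A subspace of maximal dimension on which [E] holds must contain every vector satisfying [E], by
   stability under sums and scalings. *)
pose P (m : nat) := `[< exists2 U : {vspace Fn}, \dim U = m & forall u, u \in U -> E u >].
have exP : exists m, P m.
  exists 0%N; apply/asboolP; exists 0%VS => [|u]; first by rewrite dimv0.
  rewrite memv0 => /eqP ->; exists 1 => // Q e /e_ge0 e0.
  by rewrite mul0mx supnorm0 mul1r.
have ubP m : P m -> (m <= \dim {:Fn})%N.
  by move=> /asboolP[U <- _]; apply: dimvS; exact: subvf.
case: (ex_maxnP exP ubP) => m /asboolP[U Um UE] mmax.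
have EU u : E u -> u \in U.
  move=> Eu; have UUu : (U <= U + <[u]>)%VS by exact: addvSl.
  have : (\dim (U + <[u]>) <= m)%N.
    apply: mmax; apply/asboolP; exists (U + <[u]>)%VS; first by [].
    by move=> _ /memv_addP[w wU [_ /vlineP[c ->] ->]]; apply: ED; [exact: UE | exact: EZ].
  rewrite -Um (geq_leqif (dimv_leqif_eq UUu)) => /eqP ->.
  by apply: subvP (memv_line u); exact: addvSr.
move=> u; apply: UE; apply: contrapT => /negP uU.
(* The projection along [U] kills every [x - x0] with [x] in [S] but not [u]; a coordinate where
   [u *m Q] is nonzero gives a hyperplane containing [S]. *)
have [Q [QU Qv _]] := orth_proj U.
have uQ : u *m Q != 0 by apply: contraNneq uU => h; rewrite -[u]subr0 -h; exact: Qv.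
have [j uQj] := rV0Pn _ uQ.
apply: (SH [set y | (y - x0) *m col j Q = 0]).
  apply: affine_hyperplane_col; apply: contra_neq uQj => f0.
  have <- : (u *m col j Q) 0 0 = (u *m Q) 0 j by rewrite colE mulmxA -colE mxE.
  by rewrite f0 mulmx0 mxE.
by move=> x /ES /EU /QU xQ /=; rewrite colE mulmxA xQ mul0mx.
Qed.

(** If all of [S] were within [r0] of [L], the projection along the direction of [L] would shrink
    the differences [x - x0], hence by [spanning_bound] every vector, by a factor of at least 2; but
    it fixes its own nonzero image. *)
Lemma planes_uniformly_far (S : set Fn) (x0 : Fn) : S x0 ->
  (forall H, affine_hyperplane H -> ~ S `<=` H) ->
  exists2 r0 : R, 0 < r0 & forall d L, (d < n)%N -> affine_plane d L ->
    exists2 x, S x & r0 <= dist x L.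
Proof.
move=> Sx0 SH; have bound := spanning_bound Sx0 SH.
have /choice[K KP] : forall i : 'I_n, exists K : R, 0 < K /\
    forall (Q : 'M[F]_n) (e : R), (forall x, S x -> supnorm ((x - x0) *m Q) <= e) ->
    supnorm ('e_i *m Q) <= K * e.
  by move=> i; have [K K0 h] := bound 'e_i; exists K.
pose M := 1 + \sum_i K i.
have sum0 : 0 <= \sum_i K i by apply: sumr_ge0 => i _; rewrite ltW// (KP i).1.
have M0 : 0 < M by rewrite /M ltr_wpDr.
have KM i : K i <= M.
  rewrite /M (bigD1 i)//= addrCA lerDl addr_ge0// sumr_ge0// => l _.
  by rewrite ltW// (KP l).1.
(* [M] bounds every [K i], so this radius forces each ['e_i *m Q] to have norm at most 1/2, whatever
   [d] and [L] are. *)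
exists (2 * M)^-1 => [|d _ dn [p [W [Wd ->]]]]; first by rewrite invr_gt0 mulr_gt0.
apply: contrapT => far.
have [v vW] : exists v, v \notin W by apply: vspace_proper; rewrite Wd.
have [Q [QW Qv Qle]] := orth_proj W.
set w := v *m Q; have w0 : w != 0.
  by apply: contraNneq vW => h; rewrite -[v]subr0 -h; exact: Qv.
(* [Q] is idempotent, as it kills [v - v *m Q], which lies in [W]. *)
have wQ : w *m Q = w.
  by apply/esym/eqP; rewrite -subr_eq0 -{1}/(v *m Q) -mulmxBl QW ?eqxx//; exact: Qv.
have small x : S x -> supnorm ((x - x0) *m Q) <= (2 * M)^-1.
  have px y : S y -> supnorm ((y - p) *m Q) < (2 * M)^-1.
    move=> Sy; apply: (le_lt_trans (proj_le_dist p y QW Qle)).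
    by rewrite ltNge; apply/negP => h; apply: far; exists y.
  move=> Sx; rewrite (_ : x - x0 = (x - p) - (x0 - p)); last by rewrite opprB subrKA.
  by rewrite mulmxBl ltW// supnormB_lt// px.
have : supnorm (w *m Q) <= supnorm w / 2.
  rewrite [X in supnorm (X *m Q)](row_sum_delta w) mulmx_suml.
  apply: supnorm_sum => [|i]; first by rewrite divr_ge0 ?supnorm_ge0.
  rewrite -scalemxAl supnormZ ler_pM ?absv_ge0 ?supnorm_ge0 ?absv_le_supnorm//.
  apply: (le_trans ((KP i).2 Q _ small)); rewrite invfM mulrCA ger_pMr ?invr_gt0//.
  by rewrite ler_pdivrMr// mul1r.
by rewrite wQ; have := supnorm_gt0 w0; lra.
Qed.

Lemma closed_affine_plane d (L : set Fn) : affine_plane d L -> closed L.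
Proof.
move=> Lp; have [p [W [_ LE]]] := Lp; have [Q [QW Qv Qle]] := orth_proj W.
rewrite -openC; apply/open_rowP => x Lx.
have xQ : (x - p) *m Q != 0.
  apply: contra_notN Lx => /eqP h; rewrite LE; exists (x - p).
    by rewrite /= -[x - p]subr0 -h; exact: Qv.
  by rewrite addrC subrK.
exists (supnorm ((x - p) *m Q)) => [|y xy Ly]; first exact: supnorm_gt0.
have /(ball_supnorm _ _ (supnorm_gt0 xQ)) := xy; apply/negP; rewrite -leNgt.
by apply: (le_trans (proj_le_dist p x QW Qle)); apply: dist_le; rewrite -LE.
Qed.

End Scale.

(** Take [r = rho / 5 ^+ j] with [j] least such that the ball meets [S] inside the thickening; by
    minimality the ball of radius [5 * r] fails this, which yields [z]. *)
Lemma maximal_radius (R : realType) (k : fieldType) (n : nat)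
  (S L : set 'rV[lfield R k]_n) (y x : 'rV[lfield R k]_n) (rho e : R) :
  L !=set0 -> 0 < rho -> 0 < e -> thickening L e y ->
  S x -> ball y rho x -> e <= dist x L ->
  exists r : R, [/\ 0 < r, 5 * r <= rho, ball y r `&` S `<=` thickening L e &
    exists z, [/\ S z, ball y (5 * r) z & e <= dist z L]].
Proof.
move=> L0 rho0 e0 ye Sx yx xe.
pose P (j : nat) := `[< ball y (rho / 5 ^+ j) `&` S `<=` thickening L e >].
have r_gt0 (j : nat) : 0 < rho / 5 ^+ j by rewrite divr_gt0// exprn_gt0.
have exP : exists j, P j.
  (* As [5 ^+ j > j > rho / e], the radius is at most [e], and the ball of radius [e] around [y]
     stays in the thickening. *)
  exists (Num.Def.archi_bound (rho / e)); apply/asboolP => z [yz _].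
  apply: (ball_thickening L0 ye); apply: le_ball yz.
  rewrite ler_pdivrMr ?exprn_gt0// mulrC -ler_pdivrMr//.
  apply: (le_trans (ltW (archi_boundP _))); first by rewrite divr_ge0// ltW.
  by rewrite -natrX ler_nat ltnW// ltn_expl.
case: (ex_minnP exP) => -[|j] /asboolP Pj jmin.
  (* The index 0 is excluded by [x], which lies in the ball of radius [rho] but not in the
     thickening. *)
  have xlt : dist x L < e by apply: Pj; split=> //; rewrite expr0 divr1.
  by have := lt_le_trans xlt xe; rewrite ltxx.
have rE : 5 * (rho / 5 ^+ j.+1) = rho / 5 ^+ j.
  by rewrite exprS invfM mulrCA mulVKf.
exists (rho / 5 ^+ j.+1); rewrite rE; split=> //.
  by rewrite ler_pdivrMr ?exprn_gt0// ler_peMr ?(ltW rho0)// exprn_ege1// ler1n.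
apply: contrapT => h; suff /jmin : P j by rewrite ltnn.
apply/asboolP => z [yz Sz]; rewrite /thickening /= ltNge; apply/negP => ze.
by apply: h; exists z.
Qed.

(** * Contraction for restrictions to small open sets *)

Section Contraction.
Variables (R : realType) (k : finFieldType) (n : nat).
Local Notation F := (lfield R k).
Local Notation Fn := 'rV[F]_n.
Variable mu : {measure set (borelType R k n) -> \bar R}.
Implicit Types U V : set Fn.

Lemma mrestr_le U V (oU : open U) (oV : open V) (A B : set Fn) :
  open A -> open B -> A `&` U `<=` B `&` V ->
  (mrestr mu (open_borel oU) A <= mrestr mu (open_borel oV) B)%E.
Proof. by move=> oA oB; apply: measure_subset; apply: open_borel; exact: openI. Qed.

Lemma non_atomic_mrestr U (oU : open U) :
  non_atomic mu -> non_atomic (mrestr mu (open_borel oU)).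
Proof.
move=> h y; change (mu ([set y] `&` U) = 0%E); have [Uy|Uy] := pselect (U y).
  by rewrite (setIidl _)// => _ ->.
by rewrite (_ : _ `&` _ = set0) ?measure0// -subset0 => _ [/= -> /Uy].
Qed.

Lemma fin_num_mrestr U V (oU : open U) (oV : open V) : U `<=` V ->
  fin_num_fun (mrestr mu (open_borel oV)) -> fin_num_fun (mrestr mu (open_borel oU)).
Proof.
move=> UV finV A mA; rewrite ge0_fin_numE//.
apply: (@le_lt_trans _ _ (mrestr mu (open_borel oV) A)).
  by apply: measure_subset; [apply: measurableI| apply: measurableI|exact: setIS];
    rewrite //; exact: open_borel.
by rewrite -ge0_fin_numE// finV.
Qed.

(** The restriction has empty support, so the conditions on its points hold vacuously. *)
Lemma contracting_null d U (oU : open U) : mu U = 0%E -> non_atomic mu ->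
  contracting d (mrestr mu (open_borel oU)).
Proof.
move=> U0 na.
have nu0 (A : set (borelType R k n)) : measurable A -> mu (A `&` U) = 0%E.
  move=> mA; apply/eqP; rewrite eq_le measure_ge0 andbT -U0.
  apply: measure_subset; [|exact: open_borel|exact: subIsetr].
  by apply: measurableI => //; exact: open_borel.
have S0 y : ~ supp (mrestr mu (open_borel oU)) y.
  by move=> /suppP/(_ setT openT I); apply; exact: nu0.
split.
- by move=> A mA; change (mu (A `&` U) \is a fin_num); rewrite nu0.
- exact: non_atomic_mrestr.
- by exists 1; split=> // y r /S0.
- by exists 1, 1, 1; split=> // L _ e delta _ _ y _ /S0.
Qed.

Section Ball.
Variables (V : set Fn) (oV : open V) (y0 : Fn) (rho : R) (rho0 : 0 < rho).
Hypothesis UV : ball y0 rho `<=` V.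
Let U : set Fn := ball y0 rho.
Let oU : open U := open_ball_row rho0.
Local Notation nu := (mrestr mu (open_borel oV)).
Local Notation nu' := (mrestr mu (open_borel oU)).

Let supp_U y : supp nu' y -> U y.
Proof. by apply: supp_mrestr_clopen; exact: closed_ball_row. Qed.

Let supp_sub y : supp nu' y -> supp nu y.
Proof. exact: supp_mrestr_subset. Qed.

Let sub_ball y (r : R) : U y -> r <= rho -> ball y r `<=` U.
Proof. by move=> Uy rr; rewrite /U -(ball_eq rho0 Uy); exact: le_ball. Qed.

(** A ball centred in [U] is contained in [U] if [r <= rho], where the doubling of [nu] applies, and
    contains [U] otherwise, where the constant 1 suffices. *)
Lemma doubling_mrestr_ball : doubling nu -> doubling nu'.
Proof.
move=> [c [c0 hc]]; exists (Num.max 1 c); split; first by rewrite lt_max ltr01.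
move=> y r Sy r0; have Uy := supp_U Sy.
have oB (s : R) : 0 < s -> open (ball y s) by exact: open_ball_row.
have r2 : 0 < 2 * r by rewrite mulr_gt0.
have [rr|rr] := leP r rho.
  apply: (@le_trans _ _ (nu (ball y (2 * r)))).
    by apply: mrestr_le; [exact: oB|exact: oB|exact: setIS].
  apply: (le_trans (hc y r (supp_sub Sy) r0)).
  apply: lee_pmul => //; first by rewrite lee_fin ltW.
    by rewrite lee_fin le_max lexx orbT.
  apply: mrestr_le; [exact: oB|exact: oB|].
  by move=> z [yz _]; split=> //; exact: sub_ball yz.
apply: (@le_trans _ _ (nu' (ball y r))).
  apply: mrestr_le; [exact: oB|exact: oB|].
  move=> z [_ Uz]; split=> //; apply: (le_ball (ltW rr)).
  by rewrite (ball_eq rho0 Uy).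
rewrite -[leLHS]mul1e; apply: lee_pmul => //.
by rewrite lee_fin le_max lexx.
Qed.

(** Otherwise the support of [nu'] would be null by non-planarity; its complement is null too, so
    [U] would be a null neighbourhood of [y0]. *)
Lemma supp_mrestr_not_planar : supp nu y0 -> non_planar nu ->
  forall H, affine_hyperplane H -> ~ supp nu' `<=` H.
Proof.
move=> Sy0 np H hH SH.
have Uy0 : U y0 by exact: ballxx.
have mS : measurable (supp nu' : set (borelType R k n)).
  rewrite -[X in measurable X]setCK; apply: measurableC; apply: open_borel.
  by rewrite openC; exact: closed_supp.
have mH : measurable (H : set (borelType R k n)).
  rewrite -[X in measurable X]setCK; apply: measurableC; apply: open_borel.
  by rewrite openC; exact: closed_affine_plane hH.
move/suppP : Sy0 => /(_ U oU Uy0); apply.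
pose m' : {measure set (borelType R k n) -> \bar R} := nu'.
transitivity (m' setT); first by change (mu (U `&` V) = mu (setT `&` U)); rewrite setTI setIidl.
have m'S : m' (supp m') = 0%E.
  apply/eqP; rewrite eq_le measure_ge0 andbT -(np H hH).
  apply: measure_subset; [| |exact: setISS].
    by apply: measurableI => //; exact: open_borel.
  by apply: measurableI => //; exact: open_borel.
rewrite -(setUv (supp m')).
apply: (eq_trans (measureU _ mS (measurableC mS) (setICr _))).
by apply: (eq_trans (congr2 +%E m'S (measure_suppC m'))); exact: adde0.
Qed.

Lemma contracting_ball d : (d < n)%N -> supp nu y0 ->
  non_atomic mu -> fin_num_fun nu -> doubling nu -> non_planar nu ->
  (exists C alpha : R, [/\ 0 < C, 0 < alpha & decaying nu C alpha V]) ->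
  contracting d nu'.
Proof.
move=> dn Sy0 na fin dbl np [C [alpha [C0 a0 dec]]].
have Uy0 : U y0 by exact: ballxx.
split; [exact: fin_num_mrestr fin|exact: non_atomic_mrestr|exact: doubling_mrestr_ball|].
have S'y0 : supp nu' y0.
  apply/suppP => B oB By0 B0.
  apply: (iffLR (suppP _ _) Sy0 (B `&` U)) => //; first exact: openI.
  by change (mu (B `&` U `&` V) = 0%E); rewrite -setIA (setIidl UV).
have [r0 r00 far] := planes_uniformly_far S'y0 (supp_mrestr_not_planar Sy0 np).
(* The decay constants serve unchanged; [r0] ensures that the support leaves the [e]-thickening of
   every [d]-plane. *)
exists C, alpha, r0; split=> // L Lp e delta /andP[e0 er0] /andP[del0 del1] y ydel Sy.
have Uy := supp_U Sy.
have L0 : L !=set0 by case: Lp => p [W [_ ->]]; exists (p + 0), 0 => //=; exact: mem0v.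
have [x Sx xr0] := far d L dn Lp.
have yx : ball y rho x by rewrite (ball_eq rho0 Uy); exact: supp_U.
have ye : thickening L e y.
  by apply: lt_trans ydel _; rewrite gtr_pMl.
have [r [rgt0 r5 rL [z [Sz yz ze]]]] :=
  maximal_radius L0 rho0 e0 ye Sx yx (le_trans (ltW er0) xr0).
exists r; split=> //.
have [H hH [LH zH]] := hyperplane_through_plane Lp e0 ze.
have r5gt0 : 0 < 5 * r by rewrite mulr_gt0.
have H0 : H !=set0 by case: L0 => a /LH Ha; exists a.
have BU : ball y (5 * r) `<=` U by exact: sub_ball.
have eD : e <= dist_norm nu H (ball y (5 * r)).
  exact: le_trans zH (dist_norm_ge H0 r5gt0 (supp_sub Sz) yz).
have D0 : 0 < dist_norm nu H (ball y (5 * r)) := lt_le_trans e0 eD.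
have oB : open (ball y (5 * r)) by exact: open_ball_row.
have BV : ball y (5 * r) `<=` V by exact: subset_trans UV.
have de0 : 0 < delta * e by exact: mulr_gt0.
have dLH : thickening L (delta * e) `<=` thickening H (delta * e).
  by move=> w; apply: le_lt_trans; exact: dist_subset.
have bound := dec y (5 * r) (supp_sub Sy) r5gt0 BV H hH (delta * e) de0 D0.
apply: (@le_trans _ _ (nu (ball y (5 * r) `&` thickening H (delta * e)))).
  apply: mrestr_le.
  - by apply: openI => //; exact: open_thickening.
  - by apply: openI => //; exact: open_thickening.
  - by apply: setISS; [exact: setIS | exact: UV].
apply: (le_trans bound); apply: lee_pmul => //.
- by rewrite lee_fin mulr_ge0 ?powR_ge0// ltW.
(* By [eD], dividing [delta * e] by the distance norm of [H] gives at most [delta]. *)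
- rewrite lee_fin ler_pM2l// ge0_ler_powR ?nnegrE ?(ltW a0) ?(ltW del0)//.
    by rewrite divr_ge0// ltW.
  by rewrite ler_pdivrMr// ler_pM2l.
(* The ball of radius [5 * r] lies in [U], so passing from [nu] to [nu'] loses no mass there. *)
- apply: mrestr_le; [exact: oB|exact: oB|].
  by move=> w [yw _]; split; [exact: yw|exact: BU].
Qed.

End Ball.
End Contraction.

Theorem theorem3p4 (R : realType) (k : finFieldType) (n d : nat)
  (hd : (d < n)%N) (mu : {measure set (borelType R k n) -> \bar R}) :
  friendly mu -> contracting_ae d mu.
Proof.
move=> [na]; apply: negligibleS => y0; apply: contra_not => -[V [oV [Vy0 fin dbl np dec]]].
(* Off the support, [y0] has a null neighbourhood, whose restricted measure is trivially
   contracting. *)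
have [Sy0|/suppP] := pselect (supp (mrestr mu (open_borel oV)) y0).
  have [rho rho0 UV] := iffLR (open_rowP V) oV y0 Vy0.
  exists (ball y0 rho), (open_ball_row rho0); split; first exact: ballxx.
  by apply: (contracting_ball (oV := oV)).
move=> h; have [U [oU Uy0 U0]] : exists U, [/\ open U, U y0 &
    mrestr mu (open_borel oV) U = 0%E].
  by apply: contrapT => g; apply: h => U oU Uy0 U0; apply: g; exists U.
have oUV : open (U `&` V) by exact: openI.
exists (U `&` V), oUV; split=> //.
exact: contracting_null.
Qed.
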